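(* Let $X$ and $Y$ be non-empty Hausdorff spaces and let $f: X\to X$ and $g: Y\to Y$ be perfect mappings. If there exists a semi-topological conjugation $h: X\to Y$ from $(X,f)$ to $(Y,g)$ (that is, a continuous surjection $h$ with $h\circ f=g\circ h$) such that $h$ is also a perfect mapping, then $c(f)\ge c(g)$. Consequently, when $h$ is a topological conjugation (that is, a homeomorphism $h:X\to Y$ with $h\circ f=g\circ h$), we have $c(f)=c(g)$. Here $c$ denotes co-compact entropy.
   Context: A continuous mapping between Hausdorff spaces is called perfect if it is a closed mapping and all its fibers (preimages of single points of the codomain) are compact. Let $X$ be a (non-empty) Hausdorff space. An open set $U\subseteq X$ is co-compact if $X\setminus U$ is a compact subset of $X$. A co-compact open cover of $X$ is an open cover of $X$ all of whose elements are co-compact. Every co-compact open cover has a finite subcover. For a co-compact open cover $\mathcal{U}$ of $X$, $N(\mathcal{U})$ is the smallest cardinality of a subcover of $\mathcal{U}$, and $H(\mathcal{U})=\log N(\mathcal{U})$. For covers $\mathcal{U},\mathcal{V}$, $\mathcal{U}\bigvee\mathcal{V}=\{U\cap V: U\in\mathcal{U}, V\in\mathcal{V}\}$, and for a map $f:X\to X$, $f^{-i}(\mathcal{U})=\{f^{-i}(U):U\in\mathcal{U}\}$ (preimages under the $i$-th iterate). For a perfect mapping $f:X\to X$ and a co-compact open cover $\mathcal{U}$, the co-compact entropy of $f$ relative to $\mathcal{U}$ is $$c(f,\mathcal{U})=\lim_{n\to\infty}\frac1n H\Big(\bigvee_{i=0}^{n-1}f^{-i}(\mathcal{U})\Big)$$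 (this limit exists), and the co-compact entropy of $f$ is $c(f)=\sup_{\mathcal{U}}c(f,\mathcal{U})\in[0,\infty]$, the supremum being over all co-compact open covers $\mathcal{U}$ of $X$. *)

(* Defs.v *)
From HB Require Import structures.
From mathcomp Require Import all_boot all_order all_algebra.
From mathcomp Require Import all_classical all_reals all_analysis.
Set Implicit Arguments.
Unset Strict Implicit.
Unset Printing Implicit Defensive.
Import Order.TTheory GRing.Theory Num.Theory.
Import numFieldNormedType.Exports.

Local Open Scope classical_set_scope.
Local Open Scope card_scope.
Local Open Scope ring_scope.

Definition closed_mapping (X Y : topologicalType) (f : X -> Y) : Prop :=
  forall A : set X, closed A -> closed (f @` A).

(* Surjectivity is not required. *)
Definition perfect (X Y : topologicalType) (f : X -> Y) : Prop :=
  [/\ continuous f, closed_mapping f & forall y, compact (f @^-1` [set y])].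

Definition homeomorphism (X Y : topologicalType) (h : X -> Y) : Prop :=
  continuous h /\ exists k : Y -> X, [/\ cancel h k, cancel k h & continuous k].

Definition semi_conjugation (X Y : topologicalType)
    (f : X -> X) (g : Y -> Y) (h : X -> Y) : Prop :=
  [/\ continuous h, set_surj [set: X] [set: Y] h & h \o f = g \o h].

Definition conjugation (X Y : topologicalType)
    (f : X -> X) (g : Y -> Y) (h : X -> Y) : Prop :=
  homeomorphism h /\ h \o f = g \o h.

Definition covers (X : Type) (U : set (set X)) : Prop :=
  \bigcup_(A in U) A = [set: X].

Definition cocompact (X : topologicalType) (A : set X) : Prop :=
  compact (~` A).

Definition cocompact_open_cover (X : topologicalType) (U : set (set X)) : Prop :=
  covers U /\ forall A, U A -> open A /\ cocompact A.

Definition subcover_card (X : Type) (U : set (set X)) (n : nat) : Prop :=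
  exists V : set (set X), [/\ V `<=` U, covers V & V #= `I_n].

(* The value is 0 when U has no finite subcover; this never happens for a
   co-compact open cover. *)
Definition cover_number (X : Type) (U : set (set X)) : nat :=
  xget 0%N [set n | subcover_card U n /\
                    forall m, subcover_card U m -> (n <= m)%N].

Definition cover_entropy (R : realType) (X : Type) (U : set (set X)) : R :=
  ln (cover_number U)%:R.

Definition cover_join (X : Type) (U V : set (set X)) : set (set X) :=
  [set A `&` B | A in U & B in V].

Definition cover_preimage (X Y : Type) (f : X -> Y) (U : set (set Y)) :
    set (set X) :=
  [set f @^-1` A | A in U].

(* The cover {X} is the identity element of cover_join, hence the natural
   value of the empty join. *)
Definition iterated_join (X : Type) (f : X -> X) (U : set (set X)) (n : nat) :
    set (set X) :=
  \big[@cover_join X / [set [set: X]]]_(i < n) cover_preimage (iter i f) U.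

Definition cocompact_entropy_rel (R : realType) (X : topologicalType)
    (f : X -> X) (U : set (set X)) : R :=
  limn (fun n : nat => n%:R^-1 * cover_entropy R (iterated_join f U n)).

Definition cocompact_entropy (R : realType) (X : topologicalType)
    (f : X -> X) : \bar R :=
  ereal_sup [set (cocompact_entropy_rel R f U)%:E |
              U in @cocompact_open_cover X].

(* Main.v *)
(* Perfect maps pull compact sets back to compact sets, so U |-> h^-1(U) sends
   co-compact open covers of Y to co-compact open covers of X. It commutes with
   joins and turns iterates of g into iterates of f; since h is surjective,
   preimage is injective on sets and on covers, hence preserves N. Thus
   c(f, h^-1(U)) and c(g, U) are limits of the same sequence. *)
Require Import Defs.
From HB Require Import structures.
From mathcomp Require Import all_boot all_order all_algebra.
From mathcomp Require Import all_classical all_reals all_analysis.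
Set Implicit Arguments.
Unset Strict Implicit.
Unset Printing Implicit Defensive.
Import Order.TTheory GRing.Theory Num.Theory.
Import numFieldNormedType.Exports.

Local Open Scope classical_set_scope.
Local Open Scope ring_scope.
Local Open Scope ereal_scope.

Lemma compact_preimage_perfect (X Y : topologicalType) (h : X -> Y)
    (K : set Y) : perfect h -> compact K -> compact (h @^-1` K).
Proof.
(* If y in K is a cluster point of h(F), then, h being closed, the fiber of y
   meets closure E for every E in F; compactness of the fiber then yields a
   cluster point of F. *)
move=> [ch clh fibh] cK F PF FK.
have [y [Ky clFy]] := cK (h @ F) _ FK.
suff [x [hxy clx]] : h @^-1` [set y] `&` cluster F !=set0.
  by exists x; split; first by rewrite /preimage /= hxy.
apply: contrapT => fib0.
(* No point of the fiber is a cluster point, so each has a neighbourhood disjoint from the closures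
   of all small enough members of F. *)
have nclus x : (h @^-1` [set y]) x ->
    \forall x' \near x & E \near powerset_filter_from F, ~ closure E x'.
  move=> hxy; apply: contrapT => nsep; apply: fib0; exists x; split=> //.
  move=> A B FA Bx; apply: contrapT => AB0; apply: nsep.
  (* The interior is taken so that [B] is a neighbourhood of every [x'] in it: a point of the
     closure of [E] there forces [E] to meet [B]. *)
  exists (B°, [set E | F E /\ E `<=` A]) => /=.
    split; first by apply: nbhs_interior.
    exact: powerset_filter_fromP.
  move=> [x' E] /= [Bx' [_ EA]] /(_ _ Bx')[z [Ez Bz]].
  by apply: AB0; exists z; split=> //; exact: EA.
(* The near-covering form of compactness makes this uniform over the fiber. Missing the fiber passes
   to smaller sets, so a single [E] in F witnesses it. *)
have /compact_near_coveringP/(_ _ _ _ _ nclus) := fibh y.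
case/near_powerset_filter_fromP.
  move=> A B AB Bfib x /Bfib nB Ax; apply: nB; exact: closure_subset Ax.
move=> E FE Efib.
have [|x Ex hxy] := clh (closure E) (@closed_closure _ E) y; last exact: (Efib x).
move=> B By; apply: clFy => //.
suff : E `<=` h @^-1` (h @` closure E) by move=> /filterS; exact.
by move=> x Ex; exists x => //; exact: subset_closure.
Qed.

Lemma cocompact_open_cover_preimage (X Y : topologicalType) (h : X -> Y)
    (U : set (set Y)) : perfect h ->
  cocompact_open_cover U -> cocompact_open_cover (cover_preimage h U).
Proof.
move=> ph [cU ocU]; split.
  by rewrite /covers /cover_preimage bigcup_image -preimage_bigcup cU.
move=> _ [A /ocU[oA kA] <-]; split.
  by case: (ph) => /continuousP ch _ _; exact: ch.
by rewrite /cocompact preimage_setC; exact: compact_preimage_perfect.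
Qed.

Lemma cover_preimage_join (X Y : Type) (h : X -> Y) (U V : set (set Y)) :
  cover_preimage h (cover_join U V) =
  cover_join (cover_preimage h U) (cover_preimage h V).
Proof.
apply/seteqP; split=> [_ [_ [A UA [B VB <-]] <-]|].
  by exists (h @^-1` A); [exists A|exists (h @^-1` B); [exists B|]].
move=> _ [_ [A UA <-] [_ [B VB <-] <-]].
by exists (A `&` B) => //; exists A => //; exists B.
Qed.

Lemma iter_semiconj (X Y : Type) (f : X -> X) (g : Y -> Y) (h : X -> Y)
    (n : nat) : h \o f = g \o h -> h \o iter n f = iter n g \o h.
Proof.
move=> hfg; apply/funext => x /=; elim: n => //= n <-.
exact: (congr1 (@^~ (iter n f x)) hfg).
Qed.

Lemma iterated_join_preimage (X Y : Type) (f : X -> X) (g : Y -> Y)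
    (h : X -> Y) (U : set (set Y)) (n : nat) : h \o f = g \o h ->
  iterated_join f (cover_preimage h U) n =
  cover_preimage h (iterated_join g U n).
Proof.
move=> hfg; rewrite /iterated_join.
(* The empty join is preserved as well: the preimage of {Y} is {X}. *)
rewrite (big_morph _ (cover_preimage_join h)
  (_ : _ = [set [set: X]])); last by rewrite /cover_preimage image_set1.
apply: eq_bigr => i _; rewrite /cover_preimage !image_comp.
apply: eq_imagel => A _ /=.
by rewrite -[LHS]/((h \o iter i f) @^-1` A) (iter_semiconj _ hfg).
Qed.

Lemma preimage_inj (X Y : Type) (h : X -> Y) :
  set_surj [set: X] [set: Y] h -> injective (preimage h).
Proof.
move=> /(surj_image_eq (@subsetT _ _)) sh A B AB.
by rewrite -(image_preimage A sh) -(image_preimage B sh) AB.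
Qed.

Lemma covers_preimage (X Y : Type) (h : X -> Y) (U : set (set Y)) :
  set_surj [set: X] [set: Y] h -> covers (cover_preimage h U) <-> covers U.
Proof.
move=> sh; rewrite /covers /cover_preimage bigcup_image -preimage_bigcup.
split=> [hU|->//]; apply: (preimage_inj sh); by rewrite hU.
Qed.

Lemma subcover_card_preimage (X Y : Type) (h : X -> Y) (U : set (set Y))
    (n : nat) : set_surj [set: X] [set: Y] h ->
  subcover_card (cover_preimage h U) n <-> subcover_card U n.
Proof.
move=> sh.
have hV (V : set (set Y)) : (cover_preimage h V #= V)%card.
  by apply: inj_card_eq => A B _ _; exact: preimage_inj.
split=> [[V [VU cV Vn]]|[V [VU cV Vn]]].
  have [W WU VE] : exists2 W, W `<=` U & cover_preimage h W = V.
    (* Since [preimage h] is injective, this selects exactly one member of [U] over each member of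
       [V], so the cardinality is unchanged. *)
    exists [set A | U A /\ V (h @^-1` A)]; first by move=> A [].
    apply/seteqP; split=> [_ [A [_ VA] <-] //|B VB].
    by have [A UA AB] := VU _ VB; exists A => //=; rewrite AB.
  exists W; split=> //; first by apply/(covers_preimage _ sh); rewrite VE.
  by rewrite -(card_eql (hV W)) VE.
exists (cover_preimage h V); split; first exact: image_subset.
  exact/(covers_preimage _ sh).
by rewrite (card_eql (hV V)).
Qed.

Lemma cover_number_preimage (X Y : Type) (h : X -> Y) (U : set (set Y)) :
  set_surj [set: X] [set: Y] h ->
  cover_number (cover_preimage h U) = cover_number U.
Proof.
(* The sets of minimal cardinalities coincide, so [xget] returns the same value, the default 0
   included. *)
move=> sh; congr (xget _ _); apply/funext => n; apply/propext.
have E m := subcover_card_preimage U m sh.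
by split=> -[/E Un minn]; split=> // m /E; exact: minn.
Qed.

Lemma cocompact_entropy_rel_preimage (R : realType) (X Y : topologicalType)
    (f : X -> X) (g : Y -> Y) (h : X -> Y) (U : set (set Y)) :
  semi_conjugation f g h ->
  cocompact_entropy_rel R f (cover_preimage h U) = cocompact_entropy_rel R g U.
Proof.
move=> [_ sh hfg]; rewrite /cocompact_entropy_rel; congr (limn _).
apply/funext => n.
by rewrite /cover_entropy (iterated_join_preimage _ _ hfg) cover_number_preimage.
Qed.

(** Every value c(g, U) occurs among the values for f, at the cover h^-1(U), so the supremum for f
    is over a larger set. *)
Lemma cocompact_entropy_semi_conjugation (R : realType)
    (X Y : topologicalType) (f : X -> X) (g : Y -> Y) (h : X -> Y) :
  semi_conjugation f g h -> perfect h ->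
  cocompact_entropy R g <= cocompact_entropy R f.
Proof.
move=> sch ph; apply: ereal_sup_le => _ [U cU <-].
exists (cover_preimage h U); first exact: cocompact_open_cover_preimage.
by rewrite (cocompact_entropy_rel_preimage _ _ sch).
Qed.

(** Images under h are preimages under its continuous inverse, hence closed for closed sets, and the
    fibers are singletons. *)
Lemma homeomorphism_perfect (X Y : topologicalType) (h : X -> Y) :
  homeomorphism h -> perfect h.
Proof.
move=> [ch [k [hk kh ck]]].
have imE (A : set X) : h @` A = k @^-1` A.
  apply/seteqP; split=> [_ [x Ax <-]|y Ay]; first by rewrite /preimage /= hk.
  by exists (k y).
split=> // [A cA|y]; first by rewrite imE; exact: (continuous_closedP _).1.
rewrite (_ : _ @^-1` _ = [set k y]); first exact: compact_set1.
by apply/seteqP; split=> x /= => [<-|->].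
Qed.

Lemma conjugation_semi (X Y : topologicalType) (f : X -> X) (g : Y -> Y)
    (h : X -> Y) : conjugation f g h -> semi_conjugation f g h.
Proof.
by move=> [[ch [k [hk kh ck]]] hfg]; split=> // y _; exists (k y).
Qed.

(** Composing h∘f = g∘h with the inverse k on both sides gives f∘k = k∘g. *)
Lemma conjugation_sym (X Y : topologicalType) (f : X -> X) (g : Y -> Y)
    (h : X -> Y) : conjugation f g h -> exists k, conjugation g f k.
Proof.
move=> [[ch [k [hk kh ck]]] hfg]; exists k; split; first by split=> //; exists h.
apply/funext => y /=; rewrite -[RHS]hk; congr k.
by have /= -> := congr1 (@^~ (k y)) hfg; rewrite kh.
Qed.

Theorem theorem3p4 (R : realType) (X Y : topologicalType)
    (X0 : [set: X] !=set0) (Y0 : [set: Y] !=set0)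
    (hX : hausdorff_space X) (hY : hausdorff_space Y)
    (f : X -> X) (g : Y -> Y) (pf : perfect f) (pg : perfect g) :
  (forall h : X -> Y, semi_conjugation f g h -> perfect h ->
     cocompact_entropy R g <= cocompact_entropy R f) /\
  (forall h : X -> Y, conjugation f g h ->
     cocompact_entropy R f = cocompact_entropy R g).
Proof.
(* Quantified over the spaces, so that it serves both for [h] and, with X and Y exchanged, for its
   inverse. *)
have le (X' Y' : topologicalType) (f' : X' -> X') (g' : Y' -> Y')
    (h : X' -> Y') : conjugation f' g' h ->
    cocompact_entropy R g' <= cocompact_entropy R f'.
  move=> ch; apply: (cocompact_entropy_semi_conjugation R (conjugation_semi ch)).
  by apply: homeomorphism_perfect; case: ch.
split=> h; first exact: cocompact_entropy_semi_conjugation.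
move=> ch; have [k ck] := conjugation_sym ch.
by apply/eqP; rewrite eq_le (le _ _ _ _ _ ch) (le _ _ _ _ _ ck).
Qed.
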